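(* Let $n,k$ be positive integers, $\mathbf{N}=\{1,\dots,n\}$, and let $\widetilde{\mathcal{PI}}^*_k$, the linear map $\psi$, the vectors $v_{\mathbf{i}}\in U^{\otimes k}$, and the operations $\bullet$ and $\star$ on $U^{\otimes k}$ be as described in the context. For any $\alpha\in\widetilde{\mathcal{PI}}^*_k$ and any $\mathbf{i}\in(\mathbf{N}\cup\{0\})^k$ we have $\alpha\bullet v_{\mathbf{i}}=\psi(\alpha)\star v_{\mathbf{i}}$.
   Context: Notation. $n,k$ are fixed positive integers; $\mathbf{N}=\{1,\dots,n\}$, $\mathbf{K}=\{1,\dots,k\}$, $\mathbf{K}'=\{1',\dots,k'\}$ (a disjoint copy of $\mathbf{K}$), $\tilde{\mathbf{K}}=\mathbf{K}\cup\mathbf{K}'$. $U$ is the complex vector space with basis $e_0,e_1,\dots,e_n$. For $\mathbf{i}=(i_1,\dots,i_k)\in(\mathbf{N}\cup\{0\})^k$ put $v_{\mathbf{i}}=e_{i_1}\otimes\dots\otimes e_{i_k}$; these vectors form a basis of $U^{\otimes k}$. $\mathcal{PI}^*_k$ is the set of all partitions $\alpha$ of subsets $A\subset\tilde{\mathbf{K}}$ (including $A=\varnothing$) into nonempty blocks such that each block intersects both $\mathbf{K}$ and $\mathbf{K}'$ non-trivially. Elements of $\tilde{\mathbf{K}}\setminus A$ are said to belong to no block of $\alpha$. $\widetilde{\mathcal{PI}}^*_k$ equals $\mathcal{PI}^*_k$ as a set, with the following multiplication $\bullet$: for a subset $X\subset\mathbf{K}$ let $X'=\{x':x\in X\}$;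 a set $C$ is a block of $\alpha\bullet\beta$ if and only if there are a block $A$ of $\alpha$ and a block $B$ of $\beta$ such that $A\cap\mathbf{K}'=(B\cap\mathbf{K})'$ and $C=(A\cap\mathbf{K})\cup(B\cap\mathbf{K}')$. $\widehat{\mathcal{PI}}^*_k=\mathcal{PI}^*_k\cup\{\mathbf{0}\}$ is a semigroup with zero $\mathbf{0}$ (its multiplication is not needed for the statement); its contracted semigroup algebra $\overline{\mathbb{C}[\widehat{\mathcal{PI}}^*_k]}=\mathbb{C}[\widehat{\mathcal{PI}}^*_k]/(\mathbf{0})$ is, as a vector space, the space with basis $\mathcal{PI}^*_k$, where $\mathbf{0}$ is identified with the zero vector. For $\alpha,\beta\in\widetilde{\mathcal{PI}}^*_k$ write $\beta\vdash\alpha$ if each block of $\beta$ is a block of $\alpha$. The map $\psi:\mathbb{C}[\widetilde{\mathcal{PI}}^*_k]\to\overline{\mathbb{C}[\widehat{\mathcal{PI}}^*_k]}$ is the linear map with $\psi(\alpha)=\sum_{\beta\vdash\alpha}\beta$ for $\alpha\in\widetilde{\mathcal{PI}}^*_k$. The operation $\star$. For $\alpha\in\mathcal{PI}^*_k$ let $\hat{M}(\alpha,\mathbf{i})$ be the set of all $\mathbf{l}\in(\mathbf{N}\cup\{0\})^k$ such that: for each block $\{a_1,\dots,a_p,b_1',\dots,b_q'\}$ of $\alpha$ (with $a_s,b_t\in\mathbf{K}$) one has $i_{a_1}=\dots=i_{a_p}=l_{b_1}=\dots=l_{b_q}\neq 0$ (this common value is the number corresponding to the block); the numbers corresponding to different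 blocks of $\alpha$ are different; and $i_a=0$ for every $a\in\mathbf{K}$ belonging to no block of $\alpha$, and $l_b=0$ for every $b\in\mathbf{K}$ such that $b'$ belongs to no block of $\alpha$. Put $\hat{M}(\mathbf{0},\mathbf{i})=\varnothing$. Set $\alpha\star v_{\mathbf{i}}=\sum_{\mathbf{l}\in\hat{M}(\alpha,\mathbf{i})}v_{\mathbf{l}}$ (which is $0$ if $\hat{M}(\alpha,\mathbf{i})=\varnothing$), and extend linearly to $x\star v_{\mathbf{i}}$ for $x\in\overline{\mathbb{C}[\widehat{\mathcal{PI}}^*_k]}$. The operation $\bullet$ on $U^{\otimes k}$. For $\alpha\in\widetilde{\mathcal{PI}}^*_k$ let $\tilde{M}(\alpha,\mathbf{i})$ be the set of all $\mathbf{l}\in(\mathbf{N}\cup\{0\})^k$ such that: for each block $\{a_1,\dots,a_p,b_1',\dots,b_q'\}$ of $\alpha$ one has $i_{a_1}=\dots=i_{a_p}=l_{b_1}=\dots=l_{b_q}$ (this common value, possibly $0$, is the number corresponding to the block); non-zero numbers which correspond to different blocks of $\alpha$ are different; and $i_a=0$ for every $a\in\mathbf{K}$ belonging to no block of $\alpha$, and $l_b=0$ for every $b\in\mathbf{K}$ such that $b'$ belongs to no block of $\alpha$. Set $\alpha\bullet v_{\mathbf{i}}=\sum_{\mathbf{l}\in\tilde{M}(\alpha,\mathbf{i})}v_{\mathbf{l}}$ (which is $0$ if $\tilde{M}(\alpha,\mathbf{i})=\varnothing$). The sets $\hat{M}(\alpha,\mathbf{i})$ and $\tilde{M}(\alpha,\mathbf{i})$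 have at most one element. *)

(* Defs.v *)
From HB Require Import structures.
From mathcomp Require Import all_boot all_order all_algebra.

Set Implicit Arguments.
Unset Strict Implicit.
Unset Printing Implicit Defensive.

Import GRing.Theory.
Local Open Scope ring_scope.

(* The vector space with basis a finite type I: a vector is the family of its
   coordinates. *)
Notation freeVec C I := {ffun I -> C^o}.

Definition bvec (C : fieldType) (I : finType) (i : I) : freeVec C I :=
  [ffun j => (j == i)%:R].

Section LinearExtension.
Variables (C : fieldType) (I : finType) (V : lmodType C) (f : I -> V).

Definition linext (x : freeVec C I) : V := \sum_i (x i : C) *: f i.

Fact linext_is_linear : linear linext.
Proof.
move=> a x y; rewrite /linext scaler_sumr -big_split; apply: eq_bigr => i _ /=.
by rewrite !ffunE scalerDl scalerA.
Qed.

HB.instance Definition _ :=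
  GRing.isLinear.Build C (freeVec C I) V *:%R linext linext_is_linear.

Lemma linext_bvec i : linext (bvec C i) = f i.
Proof.
rewrite /linext (bigD1 i) //= big1 ?addr0 => [|j ne_ji]; rewrite ffunE.
  by rewrite eqxx scale1r.
by rewrite (negbTE ne_ji) scale0r.
Qed.
End LinearExtension.

(* Disjoint union of K and its copy K': inl a stands for a, inr b for b'.
   The elements 1, ..., k are represented by 0, ..., k - 1. *)
Definition Ktilde (k : nat) : finType := ('I_k + 'I_k)%type.

Definition meetsK k (B : {set Ktilde k}) := [exists a : 'I_k, inl a \in B].
Definition meetsK' k (B : {set Ktilde k}) := [exists b : 'I_k, inr b \in B].

Definition is_PIstar k (P : {set {set Ktilde k}}) : bool :=
  [exists A : {set Ktilde k}, partition P A] &&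
  [forall B in P, meetsK B && meetsK' B].

(* The set PI*_k, underlying both the semigroup tilde PI*_k and, up to the
   adjoined zero, the semigroup hat PI*_k. Only these sets matter below, not
   the two multiplications. *)
Record PIstar (k : nat) : predArgType := MkPIstar {
  blocks : {set {set Ktilde k}};
  blocksP : is_PIstar blocks }.

HB.instance Definition _ k := [isSub for @blocks k].
HB.instance Definition _ k := [Finite of PIstar k by <:].

Definition subdiag k (beta alpha : PIstar k) : bool :=
  [forall B in blocks beta, B \in blocks alpha].

(* The source is C[tilde PI*_k]; the target is the contracted algebra of
   hat PI*_k, whose basis is PI*_k since the zero of hat PI*_k is sent to the
   zero vector. *)
Definition psi (C : fieldType) (k : nat) :
    {linear freeVec C (PIstar k) -> freeVec C (PIstar k)} :=
  linext (fun alpha : PIstar k =>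
            \sum_(beta : PIstar k | subdiag beta alpha) bvec C beta).

(* 'I_n.+1 is N together with 0, and 0 is ord0. *)
Definition multiIndex (n k : nat) : finType := {ffun 'I_k -> 'I_n.+1}.

Notation Uspace C n := (freeVec C 'I_n.+1).
(* The k-th tensor power of U, as the space of k-dimensional arrays: tensor u
   is the decomposable tensor u_1 (x) ... (x) u_k. *)
Notation tensorU C n k := (freeVec C (multiIndex n k)).

Definition tensor (C : fieldType) (n k : nat) (u : 'I_k -> Uspace C n) :
    tensorU C n k :=
  [ffun l : multiIndex n k => \prod_(j < k) (u j (l j) : C)].

Definition ebasis (C : fieldType) (n : nat) (j : 'I_n.+1) : Uspace C n :=
  bvec C j.

Definition vvec (C : fieldType) (n k : nat) (i : multiIndex n k) :
    tensorU C n k :=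
  tensor (fun j => ebasis C (i j)).

Lemma vvecE (C : fieldType) n k (i : multiIndex n k) : vvec C i = bvec C i.
Proof.
apply/ffunP => l; rewrite !ffunE.
have [->|ne_li] := eqVneq l i.
  by rewrite big1 // => j _; rewrite ffunE eqxx.
have /existsP[j ne_j] : [exists j, l j != i j].
  by apply: contra_neqT ne_li => /existsPn h; apply/ffunP => j; apply/eqP/negPn.
by rewrite (bigD1 j) //= ffunE (negbTE ne_j) mul0r.
Qed.

Section Action.
Variables (C : fieldType) (n k : nat).
Implicit Types (alpha : PIstar k) (i l : multiIndex n k).

(* The numbers attached to the elements of Ktilde: i_a to a and l_b to b'. *)
Definition label i l (x : Ktilde k) : 'I_n.+1 :=
  match x with inl a => i a | inr b => l b end.

Definition const_on_blocks alpha i l : bool :=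
  [forall B in blocks alpha, forall x in B, forall y in B,
     label i l x == label i l y].

Definition zero_off_blocks alpha i l : bool :=
  [forall x, (x \notin cover (blocks alpha)) ==> (label i l x == ord0)].

Definition hatM alpha i : {set multiIndex n k} :=
  [set l | [&& const_on_blocks alpha i l,
     [forall B in blocks alpha, forall x in B, label i l x != ord0],
     [forall B in blocks alpha, forall D in blocks alpha, (B != D) ==>
        [forall x in B, forall y in D, label i l x != label i l y]]
     & zero_off_blocks alpha i l]].

Definition tildeM alpha i : {set multiIndex n k} :=
  [set l | [&& const_on_blocks alpha i l,
     [forall B in blocks alpha, forall D in blocks alpha, (B != D) ==>
        [forall x in B, forall y in D,
           (label i l x != ord0) && (label i l y != ord0) ==>
           (label i l x != label i l y)]]
     & zero_off_blocks alpha i l]].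

(* Both operations are extended linearly from the basis v_i of the tensor
   power; see star_vvec and bullet_vvec. *)
Definition star_elt alpha : {linear tensorU C n k -> tensorU C n k} :=
  linext (fun i => \sum_(l in hatM alpha i) vvec C l).

Definition star (x : freeVec C (PIstar k)) (t : tensorU C n k) :
    tensorU C n k :=
  linext (fun alpha => star_elt alpha t) x.

Definition bullet alpha : {linear tensorU C n k -> tensorU C n k} :=
  linext (fun i => \sum_(l in tildeM alpha i) vvec C l).

Lemma star_vvec alpha i :
  star (bvec C alpha) (vvec C i) = \sum_(l in hatM alpha i) vvec C l.
Proof. by rewrite /star linext_bvec vvecE; apply: linext_bvec. Qed.

Lemma bullet_vvec alpha i :
  bullet alpha (vvec C i) = \sum_(l in tildeM alpha i) vvec C l.
Proof. by rewrite vvecE; apply: linext_bvec. Qed.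
End Action.

(* Main.v *)
Require Import Defs.
From HB Require Import structures.
From mathcomp Require Import all_boot all_order all_algebra.
From mathcomp Require Import reals complex.

(** Fix [alpha] and [i], and compare the coefficients of [v_l] on both sides.
    On the left it is 1 or 0 according to whether [l] lies in [tildeM alpha i].
    On the right it counts the [beta] made of blocks of [alpha] for which [l]
    lies in [hatM beta i].  In [hatM] every block carries a nonzero number and
    every point outside the blocks carries 0, so such a [beta] has no freedom:
    it consists of exactly those blocks of [alpha] whose number is nonzero
    ([nz_part]).  Conversely, forgetting the blocks of [alpha] with number 0
    turns the conditions defining [tildeM alpha i] into those defining
    [hatM (nz_part alpha i l) i].  Hence the count is 1 if [l] lies in
    [tildeM alpha i] and 0 otherwise ([subdiag_hatM]). *)

Import GRing.Theory.
Local Open Scope ring_scope.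

Lemma PIstar_trivIset {k} (alpha : PIstar k) : trivIset (blocks alpha).
Proof.
by have /andP[/existsP[A /and3P[]]] := blocksP alpha.
Qed.

Lemma block_inhabited {k} {alpha : PIstar k} {B : {set Ktilde k}} :
  B \in blocks alpha -> exists x, x \in B.
Proof.
have /andP[_ /forall_inP h] := blocksP alpha.
by case/h/andP=> /existsP[a aB] _; exists (inl a).
Qed.

Lemma block_unique {k} {alpha : PIstar k} {B D : {set Ktilde k}} {x} :
  B \in blocks alpha -> D \in blocks alpha -> x \in B -> x \in D -> B = D.
Proof.
move=> Ba Da xB xD; have tI := PIstar_trivIset alpha.
by rewrite -(def_pblock tI Ba xB) (def_pblock tI Da xD).
Qed.

(** The subset of the points partitioned by a member of [PIstar] is arbitrary,
    so discarding blocks stays within [PIstar]. *)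
Lemma is_PIstar_sub {k} {alpha : PIstar k} {P : {set {set Ktilde k}}} :
  P \subset blocks alpha -> is_PIstar P.
Proof.
move=> /subsetP sPa; have /andP[_ /forall_inP h] := blocksP alpha.
apply/andP; split; last by apply/forall_inP => B /sPa /h.
apply/existsP; exists (cover P); apply/and3P; split=> //.
  by apply: trivIsetS (PIstar_trivIset alpha); apply/subsetP.
apply/negP => /sPa /block_inhabited[x].
by rewrite inE.
Qed.

Section NonzeroPart.
Variables (n k : nat) (alpha : PIstar k) (i l : multiIndex n k).

Definition nz_blocks : {set {set Ktilde k}} :=
  [set B in blocks alpha | [exists x in B, label i l x != ord0]].

Fact nz_blocks_sub : nz_blocks \subset blocks alpha.
Proof. by apply/subsetP => B; rewrite inE => /andP[]. Qed.

Definition nz_part : PIstar k := MkPIstar (is_PIstar_sub nz_blocks_sub).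

Lemma mem_nz_part {B x} :
  B \in blocks alpha -> x \in B -> label i l x != ord0 ->
  B \in blocks nz_part.
Proof. by move=> Ba xB nzx; rewrite inE Ba; apply/exists_inP; exists x. Qed.

(** A block of [alpha] outside [beta] is disjoint from every block of [beta],
    so its points are off the blocks of [beta] and must carry 0. *)
Lemma hatM_block {beta : PIstar k} {B x} :
  subdiag beta alpha -> l \in hatM beta i ->
  B \in blocks alpha -> x \in B -> label i l x != ord0 ->
  B \in blocks beta.
Proof.
move=> /forall_inP sba; rewrite inE => /and4P[_ _ _ /forallP zoff] Ba xB nzx.
have /bigcupP[D Db xD] : x \in cover (blocks beta).
  by apply: contraNT nzx; apply/implyP.
by rewrite (block_unique Ba (sba _ Db) xB xD).
Qed.

Lemma hatM_nz_part (beta : PIstar k) :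
  subdiag beta alpha -> l \in hatM beta i -> beta = nz_part.
Proof.
move=> sba hl; apply: val_inj; apply/setP => B /=; rewrite inE.
apply/idP/andP => [Bb | [Ba /exists_inP[x xB nzx]]]; last first.
  exact: hatM_block hl Ba xB nzx.
have Ba : B \in blocks alpha by apply: (forall_inP sba).
split=> //; have [x xB] := block_inhabited Bb.
apply/exists_inP; exists x => //.
move: hl; rewrite inE => /and4P[_ /forall_inP nz _ _].
exact: (forall_inP (nz _ Bb)).
Qed.

(** The blocks of [alpha] missing from [beta] carry only 0: they are trivially
    constant, and [tildeM] requires distinct numbers on different blocks only
    when both are nonzero, that is, when both blocks belong to [beta]. *)
Lemma hatM_tildeM (beta : PIstar k) :
  subdiag beta alpha -> l \in hatM beta i -> l \in tildeM alpha i.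
Proof.
move=> sba hl; have inb B x := @hatM_block beta B x sba hl.
move: hl; rewrite !inE => /and4P[/forall_inP cst _ /forall_inP dif /forallP zoff].
apply/and3P; split.
- apply/forall_inP => B Ba; apply/forall_inP => x xB; apply/forall_inP => y yB.
  have [Bb | nBb] := boolP (B \in blocks beta).
    by have /forall_inP/(_ _ xB)/forall_inP/(_ _ yB) := cst _ Bb.
  have z w : w \in B -> label i l w = ord0.
    by move=> wB; apply/eqP; apply: contraNT nBb; apply: inb.
  by rewrite !z.
- apply/forall_inP => B Ba; apply/forall_inP => D Da; apply/implyP => neBD.
  apply/forall_inP => x xB; apply/forall_inP => y yD.
  apply/implyP => /andP[nzx nzy].
  have /forall_inP/(_ _ (inb _ _ Da yD nzy))/implyP/(_ neBD) :=
    dif _ (inb _ _ Ba xB nzx).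
  by move=> /forall_inP/(_ _ xB)/forall_inP/(_ _ yD).
- apply/forallP => x; apply/implyP => nxa; apply: (implyP (zoff x)).
  apply: contra nxa => /bigcupP[B Bb xB].
  by apply/bigcupP; exists B => //; apply: (forall_inP sba).
Qed.

(** Numbers are constant on blocks, so a single point with nonzero number, as
    in the definition of [nz_blocks], makes the whole block nonzero. *)
Lemma tildeM_hatM : l \in tildeM alpha i -> l \in hatM nz_part i.
Proof.
rewrite !inE => /and3P[/forall_inP cst /forall_inP dif /forallP zoff].
have sub B : B \in blocks nz_part -> B \in blocks alpha.
  exact: (subsetP nz_blocks_sub).
have nz B x : B \in blocks nz_part -> x \in B -> label i l x != ord0.
  move=> Bn xB; have Ba := sub _ Bn.
  move: Bn; rewrite inE => /andP[_ /exists_inP[y yB nzy]].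
  by have /forall_inP/(_ _ xB)/forall_inP/(_ _ yB)/eqP-> := cst _ Ba.
apply/and4P; split.
- by apply/forall_inP => B /sub; apply: cst.
- by apply/forall_inP => B Bn; apply/forall_inP => x; apply: nz.
- apply/forall_inP => B Bn; apply/forall_inP => D Dn; apply/implyP => neBD.
  apply/forall_inP => x xB; apply/forall_inP => y yD.
  have /forall_inP/(_ _ (sub _ Dn))/implyP/(_ neBD) := dif _ (sub _ Bn).
  move=> /forall_inP/(_ _ xB)/forall_inP/(_ _ yD)/implyP; apply.
  by rewrite (nz B) // (nz D).
- apply/forallP => x; apply/implyP; apply: contraNT => nzx.
  have /bigcupP[B Ba xB] : x \in cover (blocks alpha).
    by apply: contraNT nzx; apply/implyP.
  by apply/bigcupP; exists B => //; apply: mem_nz_part nzx.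
Qed.

(** The coefficient comparison: the terms of [psi alpha] that send [v_i] to
    [v_l] reduce to the single one indexed by [nz_part], present exactly when
    [alpha] itself sends [v_i] to [v_l] under [bullet]. *)
Lemma subdiag_hatM (beta : PIstar k) :
  subdiag beta alpha && (l \in hatM beta i)
  = (l \in tildeM alpha i) && (beta == nz_part).
Proof.
apply/andP/andP => [[sba hl] | [tl /eqP->]].
  by split; [apply: hatM_tildeM hl | apply/eqP; apply: hatM_nz_part].
split; last exact: tildeM_hatM.
by apply/forall_inP; apply: (subsetP nz_blocks_sub).
Qed.

End NonzeroPart.

Lemma star_psi_vvec (C : fieldType) n k (alpha : PIstar k) (i : multiIndex n k) :
  star (psi C k (bvec C alpha)) (vvec C i)
  = \sum_(beta | subdiag beta alpha) \sum_(l in hatM beta i) vvec C l.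
Proof.
rewrite /psi /= linext_bvec /star linear_sum; apply: eq_bigr => beta _.
exact: star_vvec.
Qed.

Theorem proposition4 (R : realType) (n k : nat) (hn : (0 < n)%N) (hk : (0 < k)%N)
    (alpha : PIstar k) (i : multiIndex n k) :
  bullet R[i] n alpha (vvec R[i] i)
  = star (psi R[i] k (bvec R[i] alpha)) (vvec R[i] i).
Proof.
(* Exchanging the sums over [beta] and [l] exposes the coefficient of [v_l]. *)
rewrite bullet_vvec star_psi_vvec (exchange_big_dep xpredT) //= big_mkcond.
apply: eq_bigr => l _; rewrite (eq_bigl _ _ (subdiag_hatM _ _ alpha i l)).
by case: (l \in _) => /=; rewrite ?big_pred1_eq ?big_pred0_eq.
Qed.
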